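(* For all integers $n\ge 0$ and $s\ge1$, the Lah numbers of order $s$ satisfy the polynomial identity $$x_s^{\overline{\overline{n}}}=\sum_{k=0}^{n}\left\lceil\!\!\left\lceil\begin{matrix} n\\ k\end{matrix}\right\rceil\!\!\right\rceil_{s}x_s^{\underline{\underline{k}}}.$$
   Context: For integers $n\ge0$, $s\ge1$, the rising and falling factorials with higher level are the polynomials $x_s^{\overline{\overline{n}}}=\prod_{i=0}^{n-1}(x+i^s)$ and $x_s^{\underline{\underline{n}}}=\prod_{i=0}^{n-1}(x-i^s)$, with $x_s^{\overline{\overline{0}}}=x_s^{\underline{\underline{0}}}=1$. For a partition $\pi=\{b_1,\dots,b_k\}$ of $[n]=\{1,\dots,n\}$ into non-empty blocks, $\operatorname{bl}\pi=\{\min b_1,\dots,\min b_k\}$. For $s\ge1$, the Stirling number of the first kind with higher level, $\left[\!\left[\begin{matrix} n\\ k\end{matrix}\right]\!\right]_{s}$ (resp. of the second kind, $\left\{\!\left\{\begin{matrix} n\\ k\end{matrix}\right\}\!\right\}_{s}$), is the number of ordered $s$-tuples $(\pi_1,\dots,\pi_s)$ of partitions of $[n]$ into $k$ non-empty cyclically ordered blocks (resp. $k$ non-empty unordered blocks) with $\operatorname{bl}\pi_1=\dots=\operatorname{bl}\pi_s$. Equivalently (known), they are determined for $n,k\ge1$ by $\left[\!\left[\begin{matrix} n\\ k\end{matrix}\right]\!\right]_{s}=\left[\!\left[\begin{matrix} n-1\\ k-1\end{matrix}\right]\!\right]_{s}+(n-1)^s\left[\!\left[\begin{matrix} n-1\\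 k\end{matrix}\right]\!\right]_{s}$ and $\left\{\!\left\{\begin{matrix} n\\ k\end{matrix}\right\}\!\right\}_{s}=\left\{\!\left\{\begin{matrix} n-1\\ k-1\end{matrix}\right\}\!\right\}_{s}+k^s\left\{\!\left\{\begin{matrix} n-1\\ k\end{matrix}\right\}\!\right\}_{s}$, both being $1$ at $(n,k)=(0,0)$ and $0$ at $(n,0)$ and $(0,n)$ for $n>0$. The Lah numbers of order $s$ are defined for integers $n,k\ge0$, $s\ge1$ by $$\left\lceil\!\!\left\lceil\begin{matrix} n\\ k\end{matrix}\right\rceil\!\!\right\rceil_{s}=\sum_{j=k}^{n}\left[\!\left[\begin{matrix} n\\ j\end{matrix}\right]\!\right]_{s}\left\{\!\left\{\begin{matrix} j\\ k\end{matrix}\right\}\!\right\}_{s},$$ and are $0$ for $n<k$. *)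

(* Defs.v *)
From HB Require Import structures.
From mathcomp Require Import all_boot all_order all_algebra all_fingroup.

Set Implicit Arguments.
Unset Strict Implicit.
Unset Printing Implicit Defensive.

Import GRing.Theory.

Local Open Scope ring_scope.

(* The paper's ground set [n] = {1, .., n} is represented by 'I_n =           *)
(* {0, .., n-1}; the shift by one preserves the order, which is all that      *)
(* block minima depend on.                                                    *)

(* The set { min b | b in pi } *)
Definition bl (n : nat) (pi : {set {set 'I_n}}) : {set 'I_n} :=
  [set x : 'I_n |
    [exists b in pi, (x \in b) && [forall y in b, (x <= y)%N]]].

(* A partition of [n] into cyclically ordered blocks is a permutation c of    *)
(* 'I_n: the blocks are the cycles of c (porbits c, fixed points included),   *)
(* and c maps each element to its successor in the cyclic order of its block. *)
Definition stirling1_level (s n k : nat) : nat :=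
  #|[set t : s.-tuple 'S_n |
      [forall i : 'I_s, #|porbits (tnth t i)| == k] &&
      [forall i : 'I_s, forall j : 'I_s,
         bl (porbits (tnth t i)) == bl (porbits (tnth t j))]]|.

(* [partition] includes the requirement that all blocks are non-empty. *)
Definition stirling2_level (s n k : nat) : nat :=
  #|[set t : s.-tuple {set {set 'I_n}} |
      [forall i : 'I_s,
         partition (tnth t i) [set: 'I_n] && (#|tnth t i| == k)] &&
      [forall i : 'I_s, forall j : 'I_s, bl (tnth t i) == bl (tnth t j)]]|.

(* For n < k the range of summation is empty, so the value is 0. *)
Definition lah_order (s n k : nat) : nat :=
  (\sum_(k <= j < n.+1) stirling1_level s n j * stirling2_level s j k)%N.

Definition rising_level (s n : nat) : {poly int} :=
  \prod_(0 <= i < n) ('X + ((i ^ s)%N%:Z)%:P).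

Definition falling_level (s n : nat) : {poly int} :=
  \prod_(0 <= i < n) ('X - ((i ^ s)%N%:Z)%:P).

(* Main.v *)
Require Import Defs.
From HB Require Import structures.
From mathcomp Require Import all_boot all_order all_algebra all_fingroup.

Set Implicit Arguments.
Unset Strict Implicit.
Unset Printing Implicit Defensive.

Import GRing.Theory.

Local Open Scope ring_scope.

(** The sequences of rising factorials, monomials and falling factorials are
linked by two connection formulas,
  rising n = sum_j [n, j] X^j   and   X^j = sum_k {j, k} falling k,
whose coefficients are the Stirling numbers of both kinds; substituting the
second in the first makes the coefficient of falling k the Lah number. So all
the work is in the connection formulas for numbers that are defined by counting
s-tuples.

An s-tuple of structures with a common set S of block minima is a free choice of
s structures having S as set of minima. For s > 0 the number of s-tuples is thus
the sum, over the sets S of cardinal k, of N(S)^s, where N(S) is the number of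
single permutations (resp. partitions) with set of minima S
([stirling1_levelE], [stirling2_levelE]). Both counts N satisfy a recurrence
under the addition of a new largest element, max: either max is a minimum, and
then it forms a block by itself, or it is not, and then it joins an existing
block:
  N(S + max) = N(S),    N(S) = w * N(S),
where on the left S is seen as a subset of n+1 elements, on the right as a
subset of n elements, and the number w of ways of joining is n for permutations
(choose the successor of max) and #|S| for partitions (choose the block);
these are [perms_with_minima_rec] and [parts_with_minima_rec].

Hence for any sequence of polynomials p,
  sum_(S in n+1) N(S)^s p_#|S| = sum_(S in n) N(S)^s (p_(#|S|+1) + w^s p_#|S|)
([sum_minima_rec]). With p_k = X^k and w = n the parenthesis is (X + n^s) X^k,
and with p_k = falling k and w = k it is X * falling k, so that induction on n
yields the rising factorial and the monomial respectively. *)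

(** * Block minima of partitions and of permutations *)

Lemma mem_bl n (P : {set {set 'I_n}}) x : partition P [set: 'I_n] ->
  (x \in bl P) = [forall y in pblock P x, (x <= y)%N].
Proof.
move=> pP; have [/eqP cP tP _] := and3P pP.
have xP : x \in cover P by rewrite cP inE.
rewrite inE; apply/existsP/idP => [[b /and3P[bP xb]]|minx].
  by rewrite (def_pblock tP bP xb).
by exists (pblock P x); rewrite pblock_mem // mem_pblock xP.
Qed.

(** Each block has exactly one minimum, so the minima form a transversal. *)
Lemma card_bl n (P : {set {set 'I_n}}) :
  partition P [set: 'I_n] -> #|bl P| = #|P|.
Proof.
move=> pP; have [_ tP P0] := and3P pP.
apply: (@card_transversal _ _ _ [set: 'I_n]).
rewrite /is_transversal pP subsetT; apply/forall_inP => B BP.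
have /set0Pn[x0 x0B] : B != set0 by apply: contraNneq P0 => <-.
case: (arg_minnP (P := [in B]) val x0B) => m mB minm.
apply/cards1P; exists m; apply/setP => y; rewrite in_setI in_set1 mem_bl //.
apply/andP/eqP => [[/forall_inP ymin yB]|->].
  apply/val_inj/anti_leq/andP; split; last exact: minm.
  by apply: ymin; rewrite (def_pblock tP BP yB).
split=> //; apply/forall_inP => z; rewrite (def_pblock tP BP mB).
exact: minm.
Qed.

Lemma porbits_partition (T : finType) (c : {perm T}) :
  partition (porbits c) [set: T].
Proof.
have -> : porbits c = [set orbit 'P <[c]>%g x | x in [set: T]].
  by apply/setP => B; apply/imsetP/imsetP => -[x _ ->];
     exists x; rewrite ?porbitE ?inE.
by apply: orbit_partition; apply/actsP => a _ x; rewrite !inE.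
Qed.

Lemma pblock_porbits (T : finType) (c : {perm T}) x :
  pblock (porbits c) x = porbit c x.
Proof.
have [_ tP _] := and3P (porbits_partition c).
by apply: def_pblock; rewrite ?imset_f ?porbit_id.
Qed.

Lemma mem_bl_porbits n (c : 'S_n) x :
  (x \in bl (porbits c)) = [forall y in porbit c x, (x <= y)%N].
Proof. by rewrite mem_bl ?porbits_partition // pblock_porbits. Qed.

Lemma porbit_sub_closed (T : finType) (c : {perm T}) (A : {pred T}) x :
  x \in A -> {in A, forall z, c z \in A} -> {subset porbit c x <= A}.
Proof.
move=> xA cA y /porbitP[i ->]; elim: i => [|i IHi]; first by rewrite perm1.
by rewrite expgSr permM cA.
Qed.

(** * Subsets of an ordinal with a new largest element *)

Lemma mem_lift_imset n (S : {set 'I_n}) x :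
  (lift ord_max x \in lift ord_max @: S) = (x \in S).
Proof. exact/mem_imset/lift_inj. Qed.

Lemma max_lift_imset n (S : {set 'I_n}) :
  (ord_max \in lift ord_max @: S) = false.
Proof. by apply/imsetP => -[x _ /eqP]; rewrite (negPf (neq_lift _ _)). Qed.

(** A subset of n+1 elements is a subset of n elements, with or without the
largest one. *)
Lemma big_set_lift (V : nmodType) n (F : {set 'I_n.+1} -> V) :
  \sum_(S : {set 'I_n.+1}) F S =
  \sum_(S : {set 'I_n})
     (F (ord_max |: lift ord_max @: S) + F (lift ord_max @: S)).
Proof.
have preK (S : {set 'I_n.+1}) :
    lift ord_max @: (lift ord_max @^-1: S) = S :\ ord_max.
  apply/setP => y; case: (unliftP ord_max y) => [u ->|->].
    by rewrite mem_lift_imset !inE eq_sym neq_lift.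
  by rewrite max_lift_imset !inE eqxx.
have liftK (S : {set 'I_n}) (B : {set 'I_n.+1}) :
    (forall x, (lift ord_max x \in B) = (x \in S)) ->
    lift ord_max @^-1: B = S.
  by move=> BS; apply/setP => x; rewrite inE.
rewrite (bigID (fun S : {set _} => ord_max \in S)) big_split /=; congr (_ + _).
  rewrite (reindex_onto (fun S : {set _} => ord_max |: lift ord_max @: S)
             (fun S : {set _} => lift ord_max @^-1: S)) /= => [|S maxS].
    apply: eq_bigl => S; rewrite setU11 (liftK S) ?eqxx // => x.
    by rewrite !inE eq_sym (negPf (neq_lift _ _)) mem_lift_imset.
  by rewrite preK setD1K.
rewrite (reindex_onto (fun S : {set _} => lift ord_max @: S)
           (fun S : {set _} => lift ord_max @^-1: S)) /= => [|S maxS].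
  by apply: eq_bigl => S; rewrite max_lift_imset (liftK S) ?eqxx // => x;
     rewrite mem_lift_imset.
by rewrite preK; apply/setDidPl; rewrite disjoint_sym disjoints1.
Qed.

Lemma card_max_lift n (S : {set 'I_n}) :
  #|ord_max |: lift ord_max @: S| = #|S|.+1.
Proof. by rewrite cardsU1 max_lift_imset card_imset //; exact: lift_inj. Qed.

(** * Counting permutations by their cycle minima *)

(** The permutation got from [c] by inserting the new largest element just
before [j] in the cycle of [j], or as a fixed point when [j] is [ord_max]. *)
Definition insert_max n (c : 'S_n) (j : 'I_n.+1) : 'S_n.+1 :=
  (lift_perm ord_max ord_max c * tperm ord_max j)%g.

Lemma insert_max_max n (c : 'S_n) j : insert_max c j ord_max = j.
Proof. by rewrite permM lift_perm_id tpermL. Qed.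

(** Injectivity suffices, as n! * (n+1) = (n+1)!: the image of [ord_max] gives
back [j], and cancelling the transposition gives back [c]. *)
Lemma insert_max_bij n :
  bijective (fun cj : 'S_n * 'I_n.+1 => insert_max cj.1 cj.2).
Proof.
apply: inj_card_bij => [[c j] [d k] /= eq_cd|].
  have jk : j = k by rewrite -(insert_max_max c j) eq_cd insert_max_max.
  rewrite jk in eq_cd *; congr pair; apply/permP => x.
  have /permP/(_ (lift ord_max x)) := mulIg _ _ _ eq_cd.
  by rewrite !lift_perm_lift => /lift_inj.
by rewrite card_prod !card_Sn card_ord factS mulnC.
Qed.

(** Insertion does not merge or split the cycles of the old elements. Each
inclusion holds because a suitable set, containing the starting point, is stable
under the permutation. *)
Lemma porbit_insert_max n (c : 'S_n) j (x y : 'I_n) :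
  (lift ord_max y \in porbit (insert_max c j) (lift ord_max x))
    = (y \in porbit c x).
Proof.
have step (T : finType) (d : {perm T}) a b :
    (d b \in porbit d a) = (b \in porbit d a).
  by rewrite -!eq_porbit_mem (porbit_perm d 1).
have insE z : insert_max c j (lift ord_max z)
    = tperm ord_max j (lift ord_max (c z)).
  by rewrite permM lift_perm_lift.
apply/idP/idP => [|yx].
  (* The orbit of x under c, together with the new element if it was inserted
     before a member of this orbit. *)
  pose A := [pred z | if unlift ord_max z is Some z' then z' \in porbit c x
    else j \in [set lift ord_max u | u in porbit c x]].
  move/(@porbit_sub_closed _ _ A); rewrite !inE !liftK porbit_id; apply=> // z.
  rewrite !inE; case: unliftP => [u -> ux|-> jx].
    rewrite insE; case: tpermP => [/eqP||_ _].
    - by rewrite eq_sym (negPf (neq_lift _ _)).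
    - by move=> <-; rewrite unlift_none imset_f // step.
    - by rewrite liftK step.
  rewrite insert_max_max; case/imsetP: jx => u ux ->.
  by rewrite liftK.
pose A := [pred z | lift ord_max z \in porbit (insert_max c j) (lift ord_max x)].
apply: (@porbit_sub_closed _ c A x) yx; rewrite ?inE ?porbit_id // => z.
rewrite !inE -step insE; case: tpermP => [/eqP|<-|//].
  by rewrite eq_sym (negPf (neq_lift _ _)).
by rewrite -step insert_max_max.
Qed.

(** The new element, being the largest, is a cycle minimum only as a fixed point,
and it never changes which old elements are minima. *)
Lemma bl_insert_max n (c : 'S_n) j :
  bl (porbits (insert_max c j)) =
  if j == ord_max then ord_max |: lift ord_max @: bl (porbits c)
  else lift ord_max @: bl (porbits c).
Proof.
have maxE : (ord_max \in bl (porbits (insert_max c j))) = (j == ord_max).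
  rewrite mem_bl_porbits; apply/forall_inP/eqP => [minmax|jE y].
    have := minmax j; rewrite -{1}(insert_max_max c j).
    rewrite -{1}(expg1 (insert_max c j)).
    rewrite mem_porbit => /(_ isT) nj.
    by apply/val_inj/anti_leq; rewrite nj leq_ord.
  move=> ymax; suff /eqP-> : y == ord_max by [].
  apply: (porbit_sub_closed (A := pred1 ord_max)) ymax; rewrite ?inE // => z.
  by move=> /eqP->; rewrite insert_max_max jE inE.
have liftE x : (lift ord_max x \in bl (porbits (insert_max c j)))
    = (x \in bl (porbits c)).
  rewrite !mem_bl_porbits; apply/forall_inP/forall_inP => minx y.
    by rewrite -(porbit_insert_max c j) => /minx; rewrite !lift_max.
  case: (unliftP ord_max y) => [u ->|-> _]; last exact: leq_ord.
  by rewrite porbit_insert_max !lift_max => /minx.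
apply/setP => y; case: (unliftP ord_max y) => [u ->|->].
  rewrite liftE; case: ifP => _; rewrite ?in_setU1 mem_lift_imset //.
  by rewrite eq_sym (negPf (neq_lift _ _)).
by rewrite maxE; case: eqP => _; rewrite ?setU11 ?max_lift_imset.
Qed.

Definition perms_with_minima n (S : {set 'I_n}) : nat :=
  #|[set c : 'S_n | bl (porbits c) == S]|.

(** The new element has [n] possible successors when it is not a fixed point. *)
Lemma perms_with_minima_rec n (S : {set 'I_n}) :
  (perms_with_minima (ord_max |: lift ord_max @: S) = perms_with_minima S) *
  (perms_with_minima (lift ord_max @: S) = n * perms_with_minima S)%N.
Proof.
have cardE (A : {set 'I_n.+1}) B (J : {set 'I_n.+1}) :
    (forall c j, (bl (porbits (@insert_max n c j)) == A) =
       (c \in [set c : 'S_n | bl (porbits c) == B]) && (j \in J)) ->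
    perms_with_minima A = (perms_with_minima B * #|J|)%N.
  move=> AB; rewrite /perms_with_minima -cardsX.
  rewrite -[LHS]sum1_card -[RHS]sum1_card.
  rewrite (reindex _ (onW_bij _ (insert_max_bij n))).
  by apply: eq_bigl => -[c j]; rewrite in_setX inE AB.
have maxlift (B C : {set 'I_n}) :
    (ord_max |: lift ord_max @: B == lift ord_max @: C) = false.
  by apply/negP => /eqP/setP/(_ ord_max); rewrite setU11 max_lift_imset.
split.
  rewrite (cardE _ S [set ord_max]) ?cards1 ?muln1 // => c j.
  rewrite bl_insert_max !inE andbC; case: (j =P ord_max) => _ /=.
    apply/eqP/eqP => [/(congr1 (fun B => B :\ ord_max))|-> //].
    by rewrite !setU1K ?max_lift_imset // => /(imset_inj lift_inj).
  by rewrite eq_sym maxlift.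
rewrite (cardE _ S [set~ ord_max]) ?cardsC1 ?card_ord 1?mulnC // => c j.
rewrite bl_insert_max !inE andbC; case: (j =P ord_max) => _ /=.
  exact: maxlift.
exact/(inj_eq (imset_inj (@lift_inj _ _))).
Qed.

(** * Counting partitions by their block minima *)

Definition parts_with_minima n (S : {set 'I_n}) : nat :=
  #|[set P : {set {set 'I_n}} | partition P [set: 'I_n] && (bl P == S)]|.

Definition block_min n (P : {set {set 'I_n}}) (x : 'I_n) : 'I_n :=
  [arg min_(y < x | y \in pblock P x) y].

Lemma block_minP n (P : {set {set 'I_n}}) x : partition P [set: 'I_n] ->
  [/\ pblock P (block_min P x) = pblock P x,
      block_min P x \in bl P,
      forall y, y \in pblock P x -> (block_min P x <= y)%N &
      (x \in bl P -> block_min P x = x)].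
Proof.
move=> pP; have [/eqP cP tP _] := and3P pP.
have xx : x \in pblock P x by rewrite mem_pblock cP inE.
rewrite /block_min; case: (arg_minnP val xx) => m mx minm.
have pm : pblock P m = pblock P x by rewrite (same_pblock tP mx).
split=> //.
  by rewrite mem_bl // pm; apply/forall_inP.
rewrite mem_bl // => /forall_inP minx; apply/val_inj/anti_leq.
by rewrite minx // minm.
Qed.

(** A partition amounts to the function sending each element to the minimum of
its block. The functions that arise from partitions with set of minima [S] are
those that fix [S] pointwise and send any other element to a smaller element of
[S]; the inverse map takes a function to the partition into its fibres. *)
Lemma parts_with_minimaE n (S : {set 'I_n}) :
  parts_with_minima S =
  (\prod_(x < n) if x \in S then 1 else #|[set y in S | y < x]|)%N.
Proof.
pose F x : pred 'I_n := if x \in S then pred1 x else [pred y in S | (y < x)%N].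
pose mf P : {ffun 'I_n -> 'I_n} := [ffun x => block_min P x].
have -> : (\prod_(x < n) if x \in S then 1 else #|[set y in S | y < x]|)%N
    = #|family F|.
  rewrite card_family foldrE big_image; apply: eq_bigr => x _.
  rewrite /F; case: ifP => _; first by rewrite card1.
  by apply: eq_card => y; rewrite !inE.
rewrite /parts_with_minima -(card_in_imset (f := mf)).
  apply: eq_card => g; apply/imsetP/familyP => [[P]|gF].
    rewrite inE => /andP[pP /eqP blP] -> x; rewrite ffunE /F -blP.
    have [_ mbl mmin mid] := block_minP x pP.
    have [/mid->|xbl] := boolP (x \in bl P); first by rewrite inE.
    apply/andP; split; first exact: mbl.
    rewrite /= ltn_neqAle mmin ?andbT.
      by apply: contraNneq xbl => /val_inj <-.
    by have [/eqP cP _ _] := and3P pP; rewrite mem_pblock cP inE.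
  have gid x : x \in S -> g x = x.
    by move=> xS; have := gF x; rewrite /F xS => /eqP.
  have gle x : (g x <= x)%N.
    have := gF x; rewrite /F; case: ifP => _; first by move/eqP->.
    by case/andP=> _ /ltnW.
  have gS x : g x \in S.
    have := gF x; rewrite /F; case: ifP => [xS /eqP-> //|_].
    by case/andP.
  (* g is recovered from its fibres: g x is the least point of the fibre of x. *)
  pose P := preim_partition g [set: 'I_n].
  have pP : partition P [set: 'I_n] := preim_partitionP g _.
  have inP x y : (y \in pblock P x) = (g x == g y).
    rewrite pblock_equivalence_partition ?inE //.
    by move=> ? ? ? _ _ _; split=> // /eqP->.
  have blP : bl P = S.
    apply/setP => x; rewrite mem_bl //; apply/forall_inP/idP => [minx|xS y].
      suff -> : x = g x by [].
      apply/val_inj/anti_leq; rewrite gle minx //.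
      by rewrite inP [g (g x)]gid.
    by rewrite inP => /eqP gxy; rewrite -(gid x xS) gxy.
  exists P; first by rewrite inE pP blP eqxx.
  apply/ffunP => x; rewrite ffunE; have [pmx mbl mmin _] := block_minP x pP.
  have : x \in pblock P (block_min P x) by rewrite pmx inP.
  by rewrite inP => /eqP <-; rewrite gid // -blP.
move=> P Q; rewrite !inE => /andP[pP _] /andP[pQ _] mPQ.
suff mK R : partition R [set: 'I_n] -> preim_partition (mf R) [set: 'I_n] = R.
  by rewrite -(mK P) // mPQ mK.
move=> pR; rewrite -[RHS](preim_partition_pblock pR).
rewrite /preim_partition /equivalence_partition; apply: eq_imset => x.
apply/setP => y; rewrite !inE !ffunE.
have [px _ minx _] := block_minP x pR; have [py _ miny _] := block_minP y pR.
apply/eqP/eqP => [mxy|pxy]; first by rewrite -px mxy.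
have [/eqP cR _ _] := and3P pR.
have minIn z : block_min R z \in pblock R z.
  by have [<- _ _ _] := block_minP z pR; rewrite mem_pblock cR inE.
by apply/val_inj/anti_leq; rewrite minx ?miny // -?pxy // pxy.
Qed.

(** In the product formula, adding a largest element leaves the old factors
unchanged, and a largest element outside [S] contributes the factor [#|S|]. *)
Lemma parts_with_minima_rec n (S : {set 'I_n}) :
  (parts_with_minima (ord_max |: lift ord_max @: S) = parts_with_minima S) *
  (parts_with_minima (lift ord_max @: S) = #|S| * parts_with_minima S)%N.
Proof.
have widenE (x : 'I_n) : widen_ord (leqnSn n) x = lift ord_max x.
  exact/val_inj/esym/lift_max.
have memE (A : {set 'I_n.+1}) :
    (forall x, (lift ord_max x \in A) = (x \in S)) ->
    parts_with_minima A = (parts_with_minima S *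
      if ord_max \in A then 1 else #|S|)%N.
  move=> AS; have belowE m : (m <= n)%N ->
      #|[set y in A | (y < m)%N]| = #|[set y in S | (y < m)%N]|.
    move=> le_m; rewrite -[RHS](card_imset _ (@lift_inj _ ord_max)).
    apply: eq_card => y; case: (unliftP ord_max y) => [u ->|->].
      by rewrite mem_lift_imset !inE AS lift_max.
    by rewrite max_lift_imset !inE ltnNge le_m andbF.
  rewrite !parts_with_minimaE big_ord_recr /=; congr (_ * _)%N.
    by apply: eq_bigr => x _; rewrite widenE AS belowE // ltnW.
  case: ifP => // _; rewrite belowE //; apply: eq_card => y.
  by rewrite inE ltn_ord andbT.
rewrite !memE ?setU11 ?max_lift_imset ?muln1 1?[(#|S| * _)%N]mulnC // => x.
  by rewrite mem_lift_imset.
by rewrite in_setU1 mem_lift_imset eq_sym (negPf (neq_lift _ _)).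
Qed.

(** * Stirling numbers as sums over sets of minima *)

Lemma card_tuple_all (T : finType) (A : {pred T}) s :
  #|[set t : s.-tuple T | [forall i, tnth t i \in A]]| = (#|A| ^ s)%N.
Proof.
rewrite -[in RHS](card_ord s) -card_ffun_on.
rewrite -(card_imset _ (can_inj (@finfun_of_tupleK T s))).
apply: eq_card => f; apply/imsetP/ffun_onP => [[t]|fA].
  by rewrite inE => /forallP tA -> i; rewrite ffunE.
exists (tuple_of_finfun f); last by rewrite tuple_of_finfunK.
by rewrite inE; apply/forallP => i; rewrite tnth_mktuple fA.
Qed.

(** Tuples are sorted by the common value [v] of [b] on their entries; positivity
of [s] makes this value well defined. *)
Lemma card_tuple_same_value (T V : finType) (A : {pred T}) (b : T -> V)
    (Q : pred V) s : (0 < s)%N ->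
  #|[set t : s.-tuple T |
      [forall i, (tnth t i \in A) && Q (b (tnth t i))] &&
      [forall i, forall j, b (tnth t i) == b (tnth t j)]]| =
  (\sum_(v | Q v) #|[set x in A | b x == v]| ^ s)%N.
Proof.
case: s => // s _; rewrite -sum1_card.
rewrite (partition_big (fun t => b (tnth t ord0)) Q) => [|t]; last first.
  by rewrite inE => /andP[/forallP/(_ ord0)/andP[]].
apply: eq_bigr => v Qv; rewrite sum1_card -card_tuple_all.
apply: eq_card => t; rewrite !inE [LHS]inE /= inE.
apply/andP/forallP => [[/andP[/forallP tA /forallP tb] /eqP t0] i|tAv].
  by rewrite inE -t0 (forallP (tb i)) andbT; case/andP: (tA i).
have tA i : (tnth t i \in A) /\ b (tnth t i) = v.
  by have := tAv i; rewrite inE => /andP[? /eqP].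
rewrite (tA _).2; split=> //; apply/andP; split.
  by apply/forallP => i; rewrite (tA i).1 (tA i).2.
by apply/forallP => i; apply/forallP => j; rewrite !(tA _).2.
Qed.

Lemma stirling1_levelE s n k : (0 < s)%N ->
  stirling1_level s n k =
  (\sum_(S : {set 'I_n} | #|S| == k) perms_with_minima S ^ s)%N.
Proof.
move=> s0; rewrite -(card_tuple_same_value predT (fun c => bl (porbits c))
  (fun S => #|S| == k) s0).
apply: eq_card => t; rewrite !inE; congr (_ && _); apply: eq_forallb => i.
by rewrite card_bl ?porbits_partition.
Qed.

Lemma stirling2_levelE s n k : (0 < s)%N ->
  stirling2_level s n k =
  (\sum_(S : {set 'I_n} | #|S| == k) parts_with_minima S ^ s)%N.
Proof.
move=> s0; rewrite -(card_tuple_same_value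
  (fun P => partition P [set: 'I_n]) (@bl n) (fun S => #|S| == k) s0).
apply: eq_card => t; rewrite !inE; congr (_ && _); apply: eq_forallb => i.
by rewrite unfold_in; apply: andb_id2l => /card_bl->.
Qed.

(** * The two connection formulas *)

Lemma sum_by_card n (f : {set 'I_n} -> nat) (p : nat -> {poly int}) :
  \sum_(0 <= k < n.+1) (\sum_(S : {set 'I_n} | #|S| == k) f S)%N%:Z *: p k =
  \sum_(S : {set 'I_n}) (f S)%:Z *: p #|S|.
Proof.
have leS (S : {set 'I_n}) : (#|S| < n.+1)%N.
  by rewrite ltnS -[leqRHS]card_ord max_card.
rewrite [RHS](partition_big (fun S => Ordinal (leS S)) predT) //= big_mkord.
apply: eq_bigr => k _; rewrite (big_morph Posz PoszD (erefl 0)) scaler_suml.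
by apply: eq_big => // S /eqP->.
Qed.

(** The step shared by both connection formulas: [N] counts the structures of one
kind by their minima, and [w] is the number of ways for a new largest element to
join a block. *)
Lemma sum_minima_rec (N : forall n, {set 'I_n} -> nat) (w : nat -> nat -> nat)
    (p : nat -> {poly int}) s n :
  (forall S : {set 'I_n},
     (N _ (ord_max |: lift ord_max @: S) = N _ S) *
     (N _ (lift ord_max @: S) = w n #|S| * N _ S)%N) ->
  \sum_(S : {set 'I_n.+1}) (N _ S ^ s)%N%:Z *: p #|S| =
  \sum_(S : {set 'I_n}) (N _ S ^ s)%N%:Z *:
     (p #|S|.+1 + (w n #|S| ^ s)%N%:Z *: p #|S|).
Proof.
move=> Nrec; rewrite big_set_lift; apply: eq_bigr => S _.
rewrite !Nrec card_max_lift card_imset; last exact: lift_inj.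
by rewrite expnMn PoszM mulrC scalerDr scalerA.
Qed.

Lemma big_set_ord0 (V : nmodType) (F : {set 'I_0} -> V) :
  \sum_(S : {set 'I_0}) F S = F set0.
Proof. by apply: big_pred1 => S; apply/esym/eqP/setP => -[]. Qed.

(** The factor ['X + n^s] adds the element n: ['X] if it is a cycle minimum,
[n^s] if not. *)
Lemma rising_level_stirling1 s n : (0 < s)%N ->
  rising_level s n = \sum_(0 <= j < n.+1) (stirling1_level s n j)%:Z *: 'X^j.
Proof.
move=> s0; under eq_bigr do rewrite stirling1_levelE //.
rewrite (sum_by_card (fun S => perms_with_minima S ^ s)%N (fun j => 'X^j)).
elim: n => [|n IHn].
  rewrite big_set_ord0 cards0 /rising_level big_nil.
  suff -> : perms_with_minima (set0 : {set 'I_0}) = 1%N by rewrite exp1n scale1r.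
  rewrite /perms_with_minima (_ : [set c | _] = setT) ?cardsT ?card_Sn //.
  by apply/setP => c; rewrite !inE; apply/eqP/setP => -[].
rewrite /rising_level big_nat_recr //= -/(rising_level s n) IHn.
rewrite (@sum_minima_rec perms_with_minima (fun n _ => n) _ s n
  (@perms_with_minima_rec n)).
rewrite mulr_suml; apply: eq_bigr => S _.
by rewrite -scalerAl mulrDr -exprSr [_ * _%:P]mulrC mul_polyC.
Qed.

(** Multiplication by ['X] adds an element, by the rule
['X * falling k = falling k.+1 + k^s * falling k]. *)
Lemma monomial_stirling2 s j : (0 < s)%N ->
  'X^j = \sum_(0 <= k < j.+1) (stirling2_level s j k)%:Z *: falling_level s k.
Proof.
move=> s0; under eq_bigr do rewrite stirling2_levelE //.
rewrite (sum_by_card (fun S => parts_with_minima S ^ s)%N).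
elim: j => [|j IHj].
  rewrite big_set_ord0 cards0 /falling_level big_nil.
  by rewrite parts_with_minimaE big_ord0 exp1n scale1r.
rewrite exprSr IHj.
rewrite (@sum_minima_rec parts_with_minima (fun _ k => k) _ s j
  (@parts_with_minima_rec j)).
rewrite mulr_suml; apply: eq_bigr => S _.
rewrite -scalerAl; congr (_ *: _).
rewrite /falling_level big_nat_recr //= mulrBr.
by rewrite [_ * _%:P]mulrC mul_polyC subrK.
Qed.

Theorem theorem3p5 (n s : nat) (hs : (1 <= s)%N) :
  rising_level s n =
  \sum_(0 <= k < n.+1) (lah_order s n k)%:Z *: falling_level s k.
Proof.
rewrite rising_level_stirling1 //.
transitivity (\sum_(0 <= j < n.+1) \sum_(0 <= k < n.+1 | (k < j.+1)%N)
    (stirling1_level s n j * stirling2_level s j k)%N%:Z *: falling_level s k).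
  apply: eq_big_nat => j /andP[_ ltj]; rewrite (monomial_stirling2 _ hs).
  rewrite scaler_sumr (big_nat_widen _ _ _ _ _ ltj) /=.
  by apply: eq_bigr => k _; rewrite scalerA PoszM.
rewrite (exchange_big_dep xpredT) //=; apply: eq_bigr => k _.
rewrite /lah_order (big_morph Posz PoszD (erefl 0)) scaler_suml.
by rewrite [RHS](@big_nat_widenl _ _ _ k 0).
Qed.
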